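(* Let $d\ge 1$ be an integer, $a>0$, $\lambda>0$ and $0<\epsilon<a/4$. Let $\omega$ be a Poisson point process on the torus $\mathbb{T}_a^d$ with intensity measure $\lambda\,dx$, and for an integer $k\ge 1$ let $N_k$ be the number of $(k-1)$-simplices of the Čech complex $\mathcal{C}_\epsilon(\omega)$. Then $$\mathbf{E}[N_k]=\frac{\lambda a^d\,\bigl(\lambda(2\epsilon)^d\bigr)^{k-1}k^d}{k!}.$$
   Context: $\mathbb{T}_a^d=\mathbb{R}^d/a\mathbb{Z}^d$, identified with $X=[0,a)^d$, is equipped with Lebesgue measure and the distance $\rho_d(x,y)=\inf_{m\in\mathbb{Z}^d}\|x-y+ma\|_\infty$. For a finite set $\omega\subset\mathbb{T}_a^d$, the Čech complex $\mathcal{C}_\epsilon(\omega)$ is the abstract simplicial complex with vertex set $\omega$ in which distinct points $v_0,\dots,v_k\in\omega$ form a $k$-simplex if and only if $\bigcap_{i=0}^k B(v_i,\epsilon)\neq\emptyset$, where $B(v,\epsilon)=\{y:\rho_d(v,y)<\epsilon\}$. A Poisson point process with intensity measure $\Lambda=\lambda\,dx$ is a random finite set $\omega$ such that the number of points $\omega(A)$ in any Borel set $A$ is Poisson with mean $\lambda|A|$, with independence over disjoint sets. *)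

(* Defs.v *)
From HB Require Import structures.
From mathcomp Require Import all_boot all_order all_algebra finmap.
From mathcomp Require Import all_classical all_reals all_analysis.

Set Implicit Arguments.
Unset Strict Implicit.
Unset Printing Implicit Defensive.

Import Order.TTheory GRing.Theory Num.Theory.
Import numFieldNormedType.Exports.

Local Open Scope classical_set_scope.
Local Open Scope ring_scope.

(* R^d, with the product of the Borel sigma-algebras of the line as its
   sigma-algebra, i.e. the Borel sigma-algebra of R^d. *)
Notation euclid R d := (d.-tuple (measurableTypeR R)).

Section prepend.
Context (R : realType) (d : nat).

Definition cons_pair (z : measurableTypeR R * euclid R d) : euclid R d.+1 :=
  [tuple of z.1 :: z.2].

Lemma measurable_cons_pair : measurable_fun setT cons_pair.
Proof. exact: measurable_cons. Qed.

HB.instance Definition _ := isMeasurableFun.Build _ _ _ _ cons_pair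
  measurable_cons_pair.

Context (mu : {sigma_finite_measure set (euclid R d) -> \bar R}).

Definition prepend : set (euclid R d.+1) -> \bar R :=
  pushforward (lebesgue_measure \x mu)%E cons_pair.

Let prepend0 : prepend set0 = 0%E.
Proof. exact: measure0. Qed.

Let prepend_ge0 A : (0 <= prepend A)%E.
Proof. exact: measure_ge0. Qed.

Let prepend_sigma_additive : semi_sigma_additive prepend.
Proof. exact: measure_semi_sigma_additive. Qed.

HB.instance Definition _ := isMeasure.Build _ _ _ prepend
  prepend0 prepend_ge0 prepend_sigma_additive.

Let prepend_sigma_finite : sigma_finite setT prepend.
Proof.
have /sigma_finiteP[F [TF ndF Foo]] := sigma_finiteT (@lebesgue_measure R).
have /sigma_finiteP[G [TG ndG Goo]] := sigma_finiteT mu.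
exists (fun n => [set v : euclid R d.+1 |
    F n (thead v) /\ G n [tuple of behead v]]).
  apply/esym/seteqP; split => // v _.
  have [i _ Fi] : (\bigcup_i F i) (thead v) by rewrite -TF.
  have [j _ Gj] : (\bigcup_j G j) [tuple of behead v] by rewrite -TG.
  exists (maxn i j) => //; split.
  - by move: Fi; exact/subsetPset/ndF/leq_maxl.
  - by move: Gj; exact/subsetPset/ndG/leq_maxr.
move=> n; have [mF Fnoo] := Foo n; have [mG Gnoo] := Goo n; split.
  apply: (@measurableI _ _ (@thead _ _ @^-1` F n)
    ((fun v : euclid R d.+1 => [tuple of behead v]) @^-1` G n)).
  - by rewrite -[X in measurable X]setTI; exact: measurable_tnth.
  - by rewrite -[X in measurable X]setTI; exact: measurable_behead.
rewrite /prepend /pushforward (_ : _ @^-1` _ = F n `*` G n); last first.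
  apply/funext => -[x v] /=; congr (_ /\ G n _).
  exact/val_inj.
by rewrite product_measure1E// lte_mul_pinfty// ge0_fin_numE.
Qed.

HB.instance Definition _ :=
  Measure_isSigmaFinite.Build _ _ _ prepend prepend_sigma_finite.

End prepend.

(* Lebesgue measure on R^d, as the d-fold product of Lebesgue measure on R. *)
Fixpoint volume (R : realType) (d : nat) :
    {sigma_finite_measure set (euclid R d) -> \bar R} :=
  match d with
  | 0 => \d_([tuple] : euclid R 0)
  | d'.+1 => prepend (volume R d')
  end.

Lemma volume_box (R : realType) (d : nat) (A : 'I_d -> set (measurableTypeR R)) :
  (forall i, measurable (A i)) ->
  volume R d [set x | forall i, A i (tnth x i)] =
  (\prod_(i < d) lebesgue_measure (A i))%E.
Proof.
elim: d A => [|d IH] A mA.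
  by rewrite big_ord0 /= diracE mem_set// => -[].
rewrite big_ord_recl /= -IH// /prepend /pushforward.
rewrite (_ : _ @^-1` _ = A ord0 `*` [set x : euclid R d |
    forall i, A (lift ord0 i) (tnth x i)]); last first.
  apply/seteqP; split => -[x v] /=.
    by move=> h; split; [have := h ord0|move=> i; have := h (lift ord0 i); rewrite tnthS].
  move=> [h0 h] i; case: (unliftP ord0 i) => [j ->|->]; last by [].
  by rewrite tnthS.
rewrite product_measure1E//.
rewrite (_ : [set x | _] = \bigcap_i
    ((fun x : euclid R d => tnth x i) @^-1` A (lift ord0 i))).
  apply: fin_bigcap_measurable => // i _.
  by rewrite -[X in measurable X]setTI; exact: measurable_tnth.
by apply/seteqP; split => x /= h; [move=> i _|move=> i]; exact: h.
Qed.

Section torus.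
Context (R : realType) (d : nat) (a : R).

(* The fundamental domain [0, a)^d. *)
Definition torus : set (euclid R d) :=
  [set x | forall i, 0 <= tnth x i < a].

(* The norm of a row vector is the maximum of the norms of its entries. *)
Definition torus_dist (x y : euclid R d) : R :=
  inf (range (fun m : 'I_d -> int =>
    `|\row_i (tnth x i - tnth y i + (m i)%:~R * a : R)|)).

Definition torus_ball (x : euclid R d) (eps : R) : set (euclid R d) :=
  [set y | torus y /\ torus_dist x y < eps].

End torus.

(* Simplices are nonempty finite sets of vertices. *)
Definition cech_complex (R : realType) (d : nat) (a eps : R)
    (w : set (euclid R d)) : set {fset euclid R d} :=
  [set s : {fset euclid R d} | s != fset0 /\ [set` s] `<=` w /\
    \bigcap_(v in [set` s]) torus_ball a v eps !=set0].

Lemma cech_complex_down (R : realType) d (a eps : R) (w : set (euclid R d))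
    (s t : {fset euclid R d}) :
  (t `<=` s)%fset -> t != fset0%fset ->
  cech_complex a eps w s -> cech_complex a eps w t.
Proof.
move=> /fsubsetP ts t0 [_ [sw [y hy]]]; split => //; split.
  by move=> v /= /ts /sw.
by exists y => v /= /ts; exact: hy.
Qed.

Definition num_simplices (V : choiceType) (K : set {fset V}) (n : nat) : nat :=
  #|` fset_set [set s | K s /\ #|` s| = n.+1] |.

Definition num_points (T : choiceType) (w A : set T) : nat :=
  #|` fset_set (w `&` A) |.

(* The B i may be setT, so the product rule for subfamilies is included. *)
Definition mutually_independent (disp : measure_display)
    (Omega : measurableType disp) (R : realType) (P : probability Omega R)
    (n : nat) (X : 'I_n -> Omega -> nat) : Prop :=
  forall B : 'I_n -> set nat,
    P (\bigcap_i (X i @^-1` B i)) = (\prod_(i < n) P (X i @^-1` B i))%E.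

Record poisson_point_process (disp : measure_display)
    (Omega : measurableType disp) (R : realType) (P : probability Omega R)
    (disp' : measure_display) (T : measurableType disp')
    (X : set T) (Lambda : set T -> \bar R) (omega : Omega -> set T) : Prop :=
  PoissonPointProcess {
    ppp_sub : forall w, omega w `<=` X ;
    ppp_finite : forall w, finite_set (omega w) ;
    ppp_measurable : forall A, measurable A -> A `<=` X ->
      measurable_fun setT (fun w => num_points (omega w) A) ;
    (* The second argument of poisson_prob is a dummy; at rate 0 the law is the
       Dirac measure at 0. *)
    ppp_poisson : forall A, measurable A -> A `<=` X -> forall B : set nat,
      P [set w | B (num_points (omega w) A)] =
      poisson_prob (fine (Lambda A)) 0%N B ;
    ppp_independent : forall (n : nat) (A : 'I_n -> set T),
      (forall i, measurable (A i) /\ A i `<=` X) -> trivIset setT A ->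
      mutually_independent P (fun i w => num_points (omega w) (A i)) }.

(* Main.v *)
(* Cut the torus into (n + 1)^d cubes and let L_n be the number of k-sets of
   occupied cubes that, in each coordinate, lie in an arc of m consecutive
   residues modulo n + 1, where m is about 2 eps (n + 1) / a.  Picking one point
   in each cube turns such a k-set into a simplex, so L_n <= N_k; since omega is
   finite and the Cech condition is open, L_n = N_k for n large.  Fatou's lemma
   then gives E[N_k] = lim E[L_n].  The cubes are independently occupied with
   probability 1 - exp (- lambda (a / (n + 1))^d), so E[L_n] reduces to counting
   k-sets of cubes.  Up to non-injective k-tuples, which are negligible, this is
   k!^-1 times the d-th power of the number of k-tuples of residues lying in an
   arc of length m; as 2 m <= n + 1 each such tuple has a unique leftmost
   residue, and their number is (n + 1) (m^k - (m - 1)^k). *)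

Require Import Defs.
From HB Require Import structures.
From mathcomp Require Import all_boot all_order all_algebra finmap.
From mathcomp Require Import all_classical all_reals all_analysis.
From mathcomp Require Import measurable_realfun zify ring lra.

Import Order.TTheory GRing.Theory Num.Theory.
Import numFieldNormedType.Exports.

Local Open Scope classical_set_scope.
Local Open Scope ring_scope.

Set Implicit Arguments.
Unset Strict Implicit.
Unset Printing Implicit Defensive.

(** * Common points of balls of the torus *)

Section cech_simplices.
Context (R : realType) (d : nat) (a eps : R).
Hypotheses (a_gt0 : 0 < a) (eps_gt0 : 0 < eps).

(** The norm is a maximum over coordinates, so the lattice shift can be chosen in each coordinate
    separately. *)
Lemma torus_dist_lt (x y : euclid R d) :
  torus_dist a x y < eps <->
  forall i, exists z : int, `|tnth x i - tnth y i + z%:~R * a| < eps.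
Proof.
have normP (v : 'rV[R]_d) : `|v| < eps <-> forall i, `|v ord0 i| < eps.
  rewrite (_ : `|v| = mx_norm v)// mx_normrE; split.
    move=> /bigmax_ltP[_ h] i; exact: (h (ord0, i)).
  by move=> h; apply/bigmax_ltP; split=> // -[j i] _; rewrite ord1/=.
split.
  move=> /inf_lt[].
    by exists (`|\row_i (tnth x i - tnth y i + 0%:~R * a)|), (fun=> 0).
  move=> _ [m _ <-] /normP h i; exists (m i); by have := h i; rewrite mxE.
move=> /choice[m h]; rewrite /torus_dist.
apply: (@le_lt_trans _ _ `|\row_i (tnth x i - tnth y i + (m i)%:~R * a)|).
  apply: ge_inf; last by exists m.
  by exists 0 => _ [m' _ <-]; exact: normr_ge0.
by apply/normP => i; rewrite mxE.
Qed.

(** Reduces the Čech condition to one circle per coordinate. The centre [c] ranges over all reals,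
    since only its class modulo [a] matters. *)
Lemma common_torus_ballP (s : set (euclid R d)) :
  \bigcap_(v in s) torus_ball a v eps !=set0 <->
  forall i, exists c : R, forall v, s v ->
    exists z : int, `|tnth v i - c + z%:~R * a| < eps.
Proof.
split.
  by move=> [y sy] i; exists (tnth y i) => v /sy[_ /torus_dist_lt]; exact.
move=> /choice[c sc].
(* Points of [torus_ball] must lie in the fundamental domain, so each centre is reduced modulo [a]
   to [[0, a)]. *)
pose y : euclid R d := [tuple c i - (Num.floor (c i / a))%:~R * a | i < d].
exists y => v /= sv; split.
  move=> i; rewrite tnth_mktuple subr_ge0 ltrBlDl.
  have /andP[h1 h2] := floor_itv (c i / a).
  rewrite ler_pdivlMr// in h1; rewrite h1/=.
  by rewrite ltr_pdivrMr// intrD mulrDl mul1r in h2.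
apply/torus_dist_lt => i; have [z vz] := sc i v sv.
exists (z - Num.floor (c i / a)); rewrite tnth_mktuple intrB.
by move: vz; congr (`|_| < _); ring.
Qed.

(** Unrolling the circle around the common centre puts all lifts in an open interval of length
    [2 * eps]; on the line there is then a leftmost vertex. *)
Lemma common_torus_ball_lift (s : set (euclid R d)) i :
  \bigcap_(v in s) torus_ball a v eps !=set0 ->
  exists u : euclid R d -> R,
    (forall v, s v -> exists z : int, tnth v i = u v + z%:~R * a) /\
    (forall v w, s v -> s w -> u v - u w < 2 * eps).
Proof.
move=> /common_torus_ballP/(_ i)[c sc].
have /choice[z zP] : forall v, exists z : int,
    s v -> `|tnth v i - c + z%:~R * a| < eps.
  move=> v; have [/sc[z zP]|nsv] := pselect (s v); first by exists z.
  by exists 0.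
exists (fun v => tnth v i + (z v)%:~R * a); split.
  by move=> v sv; exists (- z v); rewrite intrN; ring.
move=> v w /zP + /zP; rewrite !ltr_norml; lra.
Qed.

End cech_simplices.

(** * Sets of cells lying in short arcs *)

(* Subtraction in 'I_n.+1 is modulo n.+1, so this says that the values of g lie
   among m cyclically consecutive residues. *)
Definition arc_fit (n m : nat) (I : finType) (g : I -> 'I_n.+1) : bool :=
  [exists l0, forall l, ((g l - g l0)%R < m)%N].

Lemma val_ord_subr n (x y : 'I_n.+1) :
  nat_of_ord (x - y)%R = if (y <= x)%N then (x - y)%N else (n.+1 - (y - x))%N.
Proof.
have [xn yn] := (ltn_ord x, ltn_ord y).
rewrite /= /GRing.add /= /GRing.opp /=; case: (posnP y) => [->|y0].
  by rewrite subn0 modnn addn0 modn_small//= subn0.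
rewrite [((n.+1 - y) %% _)%N]modn_small; last by lia.
case: leqP => yx.
  rewrite (_ : _ + _ = x - y + n.+1)%N; last by lia.
  by rewrite modnDr modn_small//; lia.
by rewrite modn_small; lia.
Qed.

(** For distinct residues the two cyclic differences add up to [n.+1], so they cannot both be below
    [m]. *)
Lemma ord_subr_anti n m (x y : 'I_n.+1) : (m.*2 <= n.+1)%N ->
  ((x - y)%R < m)%N -> ((y - x)%R < m)%N -> x = y.
Proof.
have [xn yn] := (ltn_ord x, ltn_ord y).
move=> mn; rewrite !val_ord_subr => xy yx; apply/val_inj => /=.
by move: xy yx; case: (leqP y x); case: (leqP x y); lia.
Qed.

Lemma ord_subr_modn n (x y : 'I_n.+1) (r : nat) (z : int) : (r <= n)%N ->
  x%:Z = y%:Z + r%:Z + z * n.+1%:Z -> nat_of_ord (x - y)%R = r.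
Proof.
have [xn yn] := (ltn_ord x, ltn_ord y).
move=> rn; rewrite val_ord_subr.
move E : (z * _) => q xE.
(* The product [z * n.+1] is not linear, so it is replaced by bounds on [q]. As [q = x - y - r] lies
   between [- 2n] and [n], only [- n.+1] and [0] survive. *)
have qz : q <= - (2 * n.+1%:Z) \/ [\/ q = - n.+1%:Z, q = 0 | n.+1%:Z <= q].
  have [z2|[z1|[z0|z1]]] : (z <= - 2)%R \/ z = -1 \/ z = 0 \/ (1 <= z)%R by lia.
  - by left; rewrite -E -mulNr ler_pM2r.
  - by right; constructor 1; rewrite -E z1 mulN1r.
  - by right; constructor 2; rewrite -E z0 mul0r.
  - by right; constructor 3; rewrite -E -[leLHS]mul1r ler_pM2r.
by case: (leqP y x) => xy; case: qz => [|[]] => qz; lia.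
Qed.

Lemma card_ord_lt n m : (m <= n)%N -> #|[set x : 'I_n | (x < m)%N]%SET| = m.
Proof.
by move=> mn; rewrite -sum1dep_card (big_ord_narrow mn) sum1_card card_ord.
Qed.

Lemma card_ord_arc n m (c : 'I_n.+1) : (m <= n.+1)%N ->
  #|[set x : 'I_n.+1 | ((x - c)%R < m)%N]%SET| = m.
Proof.
move=> mn; rewrite -[RHS](card_ord_lt mn) -[RHS](card_imset _ (addIr c)).
apply: eq_card => x; rewrite inE; apply/idP/imsetP => [xm|[y ym ->]].
  by exists (x - c); rewrite ?inE// subrK.
by rewrite addrK; rewrite inE in ym.
Qed.

Lemma card_arc_fit n m (I : finType) : (0 < #|I|)%N -> (m.*2 <= n.+1)%N ->
  #|[set g : {ffun I -> 'I_n.+1} | arc_fit m g]%SET| =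
  (n.+1 * (m ^ #|I| - m.-1 ^ #|I|))%N.
Proof.
move=> I0 mn.
pose A c := [set x : 'I_n.+1 | ((x - c)%R < m)%N]%SET.
have mn' : (m <= n.+1)%N by lia.
(* Each fitting tuple has exactly one value c at which its arc starts; the
   tuples starting at c are those in the arc [A c] minus those avoiding c. *)
pose first (g : {ffun I -> 'I_n.+1}) c :=
  [&& [exists l, g l == c] & [forall l, g l \in A c]].
have firstU (g : {ffun I -> 'I_n.+1}) : (\sum_c first g c)%N = arc_fit m g.
  have [|gm] := boolP (arc_fit m g); last first.
    rewrite big1// => c _; apply/eqP; rewrite eqb0; apply: contra gm.
    move=> /andP[/existsP[l /eqP <-] /forallP gm]; apply/existsP; exists l.
    by apply/forallP => l'; have := gm l'; rewrite inE.
  move=> /existsP[l /forallP gm].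
  rewrite (bigD1 (g l))//= big1 ?addn0.
    by apply/eqP; rewrite eqb1; apply/andP; split;
      [apply/existsP; exists l|apply/forallP => l'; rewrite inE].
  move=> c cl; apply/eqP; rewrite eqb0; apply: contra cl.
  move=> /andP[/existsP[l' /eqP <-] /forallP gm']; apply/eqP.
  (* Two starting values would each lie fewer than [m] steps after the other. *)
  by apply: (ord_subr_anti mn) => //; have := gm' l; rewrite inE.
have cardA c : #|[set g : {ffun I -> 'I_n.+1} | first g c]%SET| =
    (m ^ #|I| - m.-1 ^ #|I|)%N.
  (* At [m = 0] the predecessor is also 0; both powers vanish because [I] is nonempty, and no tuple
     fits an empty arc. *)
  have [m0|m0] := posnP m.
    rewrite m0 !exp0n// subnn; apply: eq_card0 => g; rewrite !inE.
    case/card_gt0P: I0 => l _; apply/negP => /andP[_ /forallP/(_ l)].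
    by rewrite inE m0.
  have cardA : #|A c| = m by exact: card_ord_arc.
  have cardA1 : #|(A c :\ c)%SET| = m.-1.
    by have := cardsD1 c (A c); rewrite cardA inE subrr m0 add1n => ->.
  rewrite -{1}cardA -cardA1 -!card_ffun_on.
  rewrite -[X in (X - _)%N]cardsE -[X in (_ - X)%N]cardsE.
  rewrite -cardsDS; last first.
    apply/fintype.subsetP => g; rewrite !inE => /ffun_onP gA.
    apply/ffun_onP => l.
    by have := gA l; rewrite in_setD1 => /andP[].
  apply: eq_card => g; rewrite [LHS]inE finset.in_setD !finset.in_set /first.
  have [/forallP gA|] := boolP [forall l, g l \in A c]; last first.
    move=> gA; rewrite andbF; apply/esym/negbTE.
    apply: contra gA => /andP[_ gA].
    exact/forallP/ffun_onP.
  rewrite andbT (introT (@ffun_onP _ _ _ _) gA) andbT; apply/existsP/negP.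
    by move=> [l /eqP glc] /ffun_onP/(_ l); rewrite in_setD1 glc eqxx.
  move=> gc; apply/existsP; apply: contra_notT gc; rewrite negb_exists.
  by move=> /forallP gc; apply/ffun_onP => l; rewrite in_setD1 gc gA.
(* Double counting of the pairs of a tuple and its starting value. *)
rewrite -sum1_card big_mkcond/=.
under eq_bigr => g _.
  rewrite inE (_ : (if _ then _ else _) = arc_fit m g :> nat); last first.
    by case: ifP.
  rewrite -firstU; over.
rewrite exchange_big/=.
under eq_bigr => c _.
  rewrite (_ : (\sum_g _)%N = (m ^ #|I| - m.-1 ^ #|I|)%N); last first.
    rewrite -(cardA c) -[RHS]sum1_card [RHS]big_mkcond/=.
    by apply: eq_bigr => g _; rewrite inE; case: (first g c).
  over.
by rewrite sum_nat_const card_ord.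
Qed.

(** Injective maps are grouped by their image: a set of size [k] is the image of exactly [k!] of
    them. *)
Lemma card_injective_ffuns_imset (T : finType) (Q : pred {set T}) k :
  (#|[set J : {set T} | Q J & #|J| == k]%SET| * k`! =
  #|[set f : {ffun 'I_k -> T} | Q (f @: [set: _]%SET) & injectiveb f]%SET|)%N.
Proof.
rewrite -[in RHS]sum1_card.
rewrite (partition_big (fun f : {ffun 'I_k -> T} => f @: [set: _]%SET)
  (mem [set J : {set T} | Q J & #|J| == k]%SET))/=; last first.
  move=> f; rewrite !inE => /andP[-> /injectiveP fI].
  by rewrite card_imset// cardsT card_ord eqxx.
rewrite -sum_nat_const; apply: eq_bigr => J; rewrite inE => /andP[QJ /eqP Jk].
rewrite -ffactnn -{1}Jk -[X in (_ ^_ X)%N]card_ord.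
rewrite -card_inj_ffuns_on -sum1_card.
apply: eq_bigl => f; rewrite !inE; apply/andP/andP.
  move=> [/ffun_onP fJ fI].
  suff /eqP -> : f @: [set: _]%SET == J by rewrite QJ fI eqxx.
  rewrite eqEcard card_imset; last exact/injectiveP.
  rewrite cardsT card_ord Jk leqnn andbT.
  by apply/fintype.subsetP => _ /imsetP[l _ ->].
move=> [/andP[_ fI] /eqP <-]; split=> //; apply/ffun_onP => l.
exact: imset_f.
Qed.

Section close_cells.
Context (d n m : nat).
Local Notation cell := {ffun 'I_d -> 'I_n.+1}.

(** The starting cell [c0] is chosen after the coordinate [i], so different coordinates may start
    their arcs at different cells of [J]. *)
Definition close_cells (J : {set cell}) : bool :=
  [forall i : 'I_d, exists c0 in J, forall c in J, ((c i - c0 i)%R < m)%N].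

Lemma close_cells_imset (I : finType) (f : {ffun I -> cell}) :
  close_cells (f @: [set: _]%SET) = [forall i, arc_fit m (fun l => f l i)].
Proof.
apply: eq_forallb => i; apply/exists_inP/existsP.
  move=> [_ /imsetP[l _ ->] /forall_inP fm]; exists l; apply/forallP => l'.
  exact/fm/imset_f.
move=> [l /forallP fm]; exists (f l); first exact: imset_f.
by apply/forall_inP => _ /imsetP[l' _ ->].
Qed.

(** Transposing [f] turns a tuple of cells into [d] independent tuples of residues, each subject
    only to [arc_fit]. *)
Lemma card_close_ffuns (I : finType) : (0 < #|I|)%N -> (m.*2 <= n.+1)%N ->
  #|[set f : {ffun I -> cell} | close_cells (f @: [set: _]%SET)]%SET| =
  ((n.+1 * (m ^ #|I| - m.-1 ^ #|I|)) ^ d)%N.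
Proof.
move=> I0 mn.
pose swap (f : {ffun I -> cell}) := [ffun i : 'I_d => [ffun l => f l i]].
have swapI : injective swap.
  move=> f g /ffunP fg; apply/ffunP => l; apply/ffunP => i.
  by have /ffunP/(_ l) := fg i; rewrite !ffunE.
rewrite -(card_arc_fit I0 mn) -[in RHS](card_ord d) -card_ffun_on.
rewrite -(card_imset _ swapI); apply: eq_card => g.
apply/imsetP/ffun_onP => [[f + ->] i|gm].
  rewrite !inE close_cells_imset => /forallP/(_ i) /existsP[l /forallP fm].
  by apply/existsP; exists l; apply/forallP => l'; rewrite !ffunE.
exists [ffun l => [ffun i => g i l]]; last first.
  by apply/ffunP => i; apply/ffunP => l; rewrite !ffunE.
rewrite inE close_cells_imset; apply/forallP => i.
have := gm i; rewrite inE => /existsP[l /forallP gl].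
by apply/existsP; exists l; apply/forallP => l'; rewrite !ffunE.
Qed.

(** [T] counts all close [k]-tuples and [J * k!] the injective ones; the difference is at most the
    number of non-injective tuples. *)
Lemma card_close_cells k : (0 < k)%N -> (m.*2 <= n.+1)%N ->
  let N := (n.+1 ^ d)%N in
  let T := ((n.+1 * (m ^ k - m.-1 ^ k)) ^ d)%N in
  let J := #|[set J : {set cell} | close_cells J & #|J| == k]%SET| in
  (T <= J * k`! + (N ^ k - N ^_ k) /\ J * k`! <= T)%N.
Proof.
move=> k0 mn N T J; rewrite card_injective_ffuns_imset.
have cardC : #|{: cell}| = N by rewrite card_ffun !card_ord.
have <- : #|[set f : {ffun 'I_k -> cell} |
    close_cells (f @: [set: _]%SET)]%SET| = T.
  by rewrite card_close_ffuns ?card_ord.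
split; last first.
  by apply/subset_leq_card/fintype.subsetP => f; rewrite !inE => /andP[].
have -> : (N ^ k - N ^_ k =
    #|~: [set f : {ffun 'I_k -> cell} | injectiveb f]|)%N.
  by rewrite [RHS]cardsCs finset.setCK card_inj_ffuns card_ffun cardC card_ord.
rewrite (leq_trans _ (leq_card_setU _ _))//.
apply/subset_leq_card/fintype.subsetP => f; rewrite !inE => ->.
by case: injectiveb.
Qed.

End close_cells.

(** * Comparison of simplices with sets of occupied cells *)

Section grid.
Context (R : realType) (d : nat) (a : R).
Hypothesis a_gt0 : 0 < a.

Definition cube n (c : {ffun 'I_d -> 'I_n.+1}) : set (euclid R d) :=
  [set x | forall i, tnth x i \in
    `[(c i)%:R * (a / n.+1%:R), (c i).+1%:R * (a / n.+1%:R)[].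

(** Off the torus [truncn] and [inord] may return the default 0, so the value locates a point only
    together with [torus a x], as in [cubeP]. *)
Definition grid_cell n (x : euclid R d) : {ffun 'I_d -> 'I_n.+1} :=
  [ffun i => inord (Num.truncn (tnth x i / (a / n.+1%:R)))].

Lemma mesh_gt0 n : 0 < a / n.+1%:R.
Proof. by rewrite divr_gt0. Qed.

Lemma mulr_mesh n : n.+1%:R * (a / n.+1%:R) = a.
Proof. by rewrite mulrC divfK ?pnatr_eq0. Qed.

Lemma cubeP n (c : {ffun 'I_d -> 'I_n.+1}) (x : euclid R d) :
  cube c x <-> torus a x /\ grid_cell n x = c.
Proof.
have h0 := mesh_gt0 n; split=> [xc|[xt <-] i].
  split=> [i|]; last apply/ffunP => i; have /= := xc i; rewrite in_itv/=.
    move=> /andP[h1 h2]; rewrite (le_trans _ h1)/=; last first.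
      by rewrite mulr_ge0 ?ler0n ?ltW.
    rewrite (lt_le_trans h2)// -[leRHS](mulr_mesh n) ler_pM2r//.
    by rewrite ler_nat.
  rewrite ffunE -ler_pdivlMr// -ltr_pdivrMr// => xc'.
  by rewrite (truncn_def xc') inord_val.
have /andP[x0 xa] := xt i; have xh0 := divr_ge0 x0 (ltW h0).
rewrite /= in_itv/= ffunE inordK.
  by rewrite -ler_pdivlMr// -ltr_pdivrMr// truncn_itv.
by rewrite truncn_lt_nat// ltr_pdivrMr// mulr_mesh.
Qed.

Lemma cube_torus n (c : {ffun 'I_d -> 'I_n.+1}) : cube c `<=` torus a.
Proof. by move=> x /cubeP[]. Qed.

Lemma measurable_cube n (c : {ffun 'I_d -> 'I_n.+1}) : measurable (cube c).
Proof.
rewrite (_ : cube c = \bigcap_i ((fun x : euclid R d => tnth x i) @^-1`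
    [set` `[(c i)%:R * (a / n.+1%:R), (c i).+1%:R * (a / n.+1%:R)[])).
  apply: fin_bigcap_measurable => // i _.
  by rewrite -[X in measurable X]setTI; exact: measurable_tnth.
by apply/seteqP; split => x /= h; [move=> i _|move=> i]; exact: h.
Qed.

Lemma volume_cube n (c : {ffun 'I_d -> 'I_n.+1}) :
  volume R d (cube c) = ((a / n.+1%:R) ^+ d)%:E.
Proof.
rewrite /cube (@volume_box R d (fun i => [set` `[(c i)%:R * (a / n.+1%:R),
  (c i).+1%:R * (a / n.+1%:R)[]))//.
under eq_bigr => i _.
  rewrite lebesgue_measure_itv/= lte_fin ltr_pM2r ?mesh_gt0// ltr_nat leqnn.
  rewrite -EFinD -mulrBl -natrB// subSnn mul1r; over.
by rewrite prodEFin prodr_const card_ord.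
Qed.

Lemma trivIset_cube n : trivIset setT (@cube n).
Proof. by move=> c c' _ _ [x [/cubeP[_ <-] /cubeP[_ <-]]]. Qed.

Definition cells_of n (s : {fset euclid R d}) : {set {ffun 'I_d -> 'I_n.+1}} :=
  [set c | c \in (grid_cell n @` s)%fset]%SET.

Definition occupied n (W : set (euclid R d)) : {set {ffun 'I_d -> 'I_n.+1}} :=
  [set c | num_points W (cube c) != 0]%SET.

Lemma occupiedP n (W : set (euclid R d)) c : finite_set W -> W `<=` torus a ->
  c \in occupied n W <-> exists2 v, W v & grid_cell n v = c.
Proof.
move=> finW Wt; rewrite inE /num_points cardfs_eq0.
have finWc : finite_set (W `&` cube c) by exact: finite_setIl.
split.
  move=> /fset0Pn[v]; rewrite in_fset_set// inE => -[Wv /cubeP[_ <-]].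
  by exists v.
move=> [v Wv vc]; apply/fset0Pn; exists v; rewrite in_fset_set// inE.
by split=> //; apply/cubeP; split=> //; exact: Wt.
Qed.

Section comparison.
Variables (eps : R) (W : set (euclid R d)) (k : nat).
Hypotheses (eps_gt0 : 0 < eps) (finW : finite_set W) (Wt : W `<=` torus a)
  (k_gt0 : (0 < k)%N).

Definition close_occupied n m : {set {set {ffun 'I_d -> 'I_n.+1}}} :=
  [set J : {set _} |
    [&& close_cells m J, #|J| == k & J \subset occupied n W]]%SET.

Lemma finite_simplices :
  finite_set [set s | cech_complex a eps W s /\ #|` s| = k].
Proof.
apply: (@sub_finite_set _ _ [set` fpowerset (fset_set W)]).
  move=> s [[_ [sW _]] _].
  rewrite /= fpowersetE; apply/fsubsetP => v vs.
  by rewrite in_fset_set// inE; exact: sW.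
exact: finite_fset.
Qed.

Lemma num_simplicesE : num_simplices (cech_complex a eps W) k.-1 =
  #|` fset_set [set s | cech_complex a eps W s /\ #|` s| = k]|.
Proof. by rewrite /num_simplices prednK. Qed.

(** In each coordinate the midpoint of the arc is within [m * h / 2 < eps] of every point of its
    cells, where [h] is the mesh. *)
Lemma close_cells_common_ball n m (J : {set {ffun 'I_d -> 'I_n.+1}})
    (s : set (euclid R d)) :
  m%:R * (a / n.+1%:R) < 2 * eps -> close_cells m J ->
  s `<=` torus a -> (forall v, s v -> grid_cell n v \in J) ->
  \bigcap_(v in s) torus_ball a v eps !=set0.
Proof.
move=> meps /forallP Jm st sJ; apply/common_torus_ballP => // i.
have /exists_inP[c0 c0J /forall_inP Jc0] := Jm i.
set h := a / n.+1%:R in meps *.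
exists ((c0 i)%:R * h + m%:R * h / 2) => v sv.
have := Jc0 _ (sJ v sv); rewrite val_ord_subr; move: (c0 i) => b.
have /(_ i)/= : cube (grid_cell n v) v by apply/cubeP; split=> //; exact: st.
rewrite in_itv/= -/h; move: (grid_cell n v i) => c /andP[h1 h2].
have h0 : 0 < h := mesh_gt0 n.
(* A cell with index below the start [b] belongs to an arc that wraps past 0; one turn, [z = 1],
   brings it back. *)
case: (leqP b c) => [cc|cc] cm; [exists 0|exists 1].
  have {}cm : c.+1%:R * h <= b%:R * h + m%:R * h.
    by rewrite -mulrDl ler_pM2r// -natrD ler_nat; lia.
  have {}cc : b%:R * h <= c%:R * h by rewrite ler_pM2r// ler_nat.
  by rewrite ltr_norml; lra.
rewrite mul1r -(mulr_mesh n) -/h.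
have {}cm : c.+1%:R * h + n.+1%:R * h <= b%:R * h + m%:R * h.
  by rewrite -!mulrDl ler_pM2r// -!natrD ler_nat; lia.
have {}cc : b%:R * h <= c%:R * h + n.+1%:R * h.
  by rewrite -mulrDl ler_pM2r// -natrD ler_nat; have := ltn_ord b; lia.
by rewrite ltr_norml; lra.
Qed.

(** Every counted [J] is [cells_of] of some simplex, so the simplices are at least as many as the
    sets [J]. *)
Lemma card_close_occupied_le n m : m%:R * (a / n.+1%:R) < 2 * eps ->
  (#|close_occupied n m| <= num_simplices (cech_complex a eps W) k.-1)%N.
Proof.
move=> meps; rewrite num_simplicesE cardE -(size_map (cells_of n)).
apply: uniq_leq_size => [|J]; first exact: enum_uniq.
rewrite mem_enum inE => /and3P[Jm /eqP Jk /fintype.subsetP JW].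
have /choice[pt ptP] : forall c, exists v,
    c \in J -> W v /\ grid_cell n v = c.
  move=> c; have [/JW/occupiedP[//|//|v Wv vc]|_] := boolP (c \in J).
    by exists v.
  (* Outside [J] any point serves as a default value; one exists because [J] is nonempty and its
     cells are occupied. *)
  by have /card_gt0P[c1 /JW/occupiedP[//|//|v _ _]] : (0 < #|J|)%N;
    [rewrite Jk|exists v].
pose s := [fset pt c | c in J]%fset.
have sP v : v \in s -> W v /\ grid_cell n v \in J.
  by move=> /imfsetP[/= c cJ ->]; have [? ->] := ptP _ cJ.
apply/mapP; exists s; last first.
  apply/setP => c; rewrite inE; apply/idP/imfsetP => [cJ|[/= v vs ->]].
    exists (pt c); last by have [_ ->] := ptP _ cJ.
    by apply/imfsetP; exists c.
  by have [] := sP _ vs.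
rewrite in_fset_set ?inE; last exact: finite_simplices.
split; last first.
  rewrite card_in_imfset/=; first by rewrite -Jk cardE.
  move=> c c' cJ c'J cc'; have [_ <-] := ptP _ cJ; have [_ <-] := ptP _ c'J.
  by rewrite cc'.
split; last split.
- have /card_gt0P[c cJ] : (0 < #|J|)%N by rewrite Jk.
  by apply/fset0Pn; exists (pt c); apply/imfsetP; exists c.
- by move=> v /sP[].
- by apply: (close_cells_common_ball meps Jm) => v /sP[/Wt].
Qed.

End comparison.
End grid.

Section near_equality.
Context (R : realType) (d : nat) (a eps : R).
Hypotheses (a_gt0 : 0 < a) (eps_gt0 : 0 < eps).

(* The predecessor makes the arcs of [mesh_width n] cells strictly shorter
   than 2 * eps, so that the points they contain have a common open ball. *)
Definition mesh_width n : nat := (Num.truncn (2 * eps / (a / n.+1%:R))).-1.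

Let h n := a / n.+1%:R.
Let h_gt0 n : 0 < h n := mesh_gt0 a_gt0 n.
Let ratio_ge0 n : 0 <= 2 * eps / h n.
Proof. by rewrite divr_ge0 ?mulr_ge0// ltW. Qed.

(** Truncation loses less than one cell and the predecessor at most one more. *)
Lemma mesh_width_gt n : 2 * eps - 2 * h n < (mesh_width n)%:R * h n.
Proof.
have /andP[_ t_gt] := truncn_itv (ratio_ge0 n); rewrite -natr1 in t_gt.
have t_le : (Num.truncn (2 * eps / h n))%:R <= (mesh_width n)%:R + 1 :> R.
  by rewrite natr1 ler_nat /mesh_width -/(h n); lia.
by rewrite -ltr_pdivrMr// mulrBl mulfK ?gt_eqF//; lra.
Qed.

Lemma mesh_width_lt n : (mesh_width n)%:R * h n < 2 * eps.
Proof.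
have /andP[le_eps _] := truncn_itv (ratio_ge0 n).
rewrite /mesh_width -/(h n); move: (Num.truncn _) le_eps => t.
rewrite -ltr_pdivlMr//; case: t => [_|t] /=.
  by rewrite divr_gt0// mulr_gt0.
by apply: lt_le_trans; rewrite ltr_nat.
Qed.

Lemma near_mesh_lt (e : R) : 0 < e -> \forall n \near \oo, h n < e.
Proof.
move=> e0; near=> n; rewrite /h ltr_pdivrMr// mulrC -ltr_pdivrMr//.
rewrite -natr1 ltr_pwDr//; near: n; exact: nbhs_infty_ger.
Unshelve. all: by end_near. Qed.

Lemma grid_cell_itv n (v : euclid R d) i : torus a v ->
  (grid_cell a n v i)%:R * h n <= tnth v i < (grid_cell a n v i)%:R * h n + h n.
Proof.
move=> vt; have /(_ i) : cube a (grid_cell a n v) v by apply/cubeP.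
by rewrite in_itv/= -[(grid_cell _ _ _ _).+1%:R]natr1 mulrDl mul1r.
Qed.

Lemma near_grid_cell_neq (v w : euclid R d) :
  torus a v -> torus a w -> v != w ->
  \forall n \near \oo, grid_cell a n v != grid_cell a n w.
Proof.
move=> vt wt vw.
have [i vwi] : exists i, tnth v i != tnth w i.
  apply/existsP; rewrite -negb_forall; apply: contra vw => /forallP vw.
  by apply/eqP/eq_from_tnth => i; exact/eqP.
near=> n; apply/negP => /eqP gvw.
have := grid_cell_itv n i vt; have := grid_cell_itv n i wt; rewrite gvw.
have : h n < `|tnth v i - tnth w i|.
  by near: n; apply: near_mesh_lt; rewrite normr_gt0 subr_eq0.
by case: ler0P; lra.
Unshelve. all: by end_near. Qed.

Hypothesis eps_lt : eps < a / 4.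

(** Here [eps < a / 4] enters: the arc is shorter than [2 * eps < a / 2], half of the circle. *)
Lemma mesh_width_le n : ((mesh_width n).*2 <= n.+1)%N.
Proof.
have := mesh_width_lt n; rewrite -(ltr_pdivlMr _ _ (h_gt0 n)) => mlt.
rewrite -(ler_nat R) -muln2 natrM -ler_pdivlMr// ltW// (lt_le_trans mlt)//.
rewrite /h ler_pdivrMr ?divr_gt0//.
rewrite (_ : _ * (a / _) = a / 2); last first.
  have : n.+1%:R != 0 :> R by rewrite pnatr_eq0.
  by move: n.+1%:R => x x0; field.
by move: eps_lt; lra.
Qed.

(** The lifts spread over strictly less than [2 * eps], and there are finitely many vertices, so a
    fine enough mesh absorbs the rounding errors. *)
Lemma near_close_cells (s : {fset euclid R d}) : s != fset0 ->
  [set` s] `<=` torus a -> \bigcap_(v in [set` s]) torus_ball a v eps !=set0 ->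
  \forall n \near \oo, close_cells (mesh_width n) (cells_of a n s).
Proof.
move=> /fset0Pn[v1 v1s] st sB.
suff : \forall n \near \oo, forall i : 'I_d,
    [exists c0 in cells_of a n s, forall c in cells_of a n s,
      ((c i - c0 i)%R < mesh_width n)%N].
  by apply: filterS => n /forallP.
apply: filter_forall => i.
have [u [uP u_lt]] := common_torus_ball_lift a_gt0 eps_gt0 i sB.
(* The cell of the vertex with the smallest lift starts the arc. *)
have [v0 v0_min] : exists v0 : s, forall v : s, u (val v0) <= u (val v).
  have [v0 _ v0_min] := arg_minP (fun v : s => u (val v))
    (erefl (xpredT [` v1s]%fset)).
  by exists v0 => v; exact: v0_min.
(* Of the three mesh steps, two pay for [mesh_width_gt] and one for rounding the vertices to
   cells. *)
have /filter_forall : forall v : s, \forall n \near \oo,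
    3 * h n <= 2 * eps - (u (val v) - u (val v0)).
  move=> v; have := u_lt _ _ (valP v) (valP v0); rewrite -subr_gt0 => gap.
  near=> n; rewrite mulrC -ler_pdivlMr//; apply/ltW.
  by near: n; apply: near_mesh_lt; rewrite divr_gt0.
apply: filterS => n h_le.
apply/exists_inP; exists (grid_cell a n (val v0)).
  by rewrite inE; apply/imfsetP; exists (val v0) => //; exact: valP.
apply/forall_inP => _ /[1!inE] /imfsetP[v vs ->].
have {}vs : v \in s by [].
have u_ge : u (val v0) <= u v := v0_min [` vs]%fset.
have u_le : 3 * h n <= 2 * eps - (u v - u (val v0)) := h_le [` vs]%fset.
have := grid_cell_itv n i (st _ (valP v0)); have := grid_cell_itv n i (st _ vs).
have [z ->] := uP _ vs; have [z0 ->] := uP _ (valP v0).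
move: (grid_cell a n v i) (grid_cell a n (val v0) i) => j j0 j_itv j0_itv.
(* The cyclic distance from the cell of v0, at which the arc starts, to that
   of v. *)
pose D : int := j%:Z - j0%:Z - (z - z0) * n.+1%:Z.
have DE : D%:~R * h n = j%:R * h n - j0%:R * h n - (z%:~R * a - z0%:~R * a).
  have := mulr_mesh a n; rewrite -/(h n); move: (h n) => x <-.
  by rewrite /D !(intrB, intrM) -[n.+1%:~R]/(n.+1%:R); ring.
have m_gt := mesh_width_gt n.
(* Minimality of [v0] and rounding give only [D > -1]; integrality does the rest. *)
have D_ge0 : 0 <= D.
  by rewrite -ltzD1 -(ltr_int R) -(ltr_pM2r (h_gt0 n)) intrD mulrDl DE; lra.
have D_lt : D < mesh_width n.
  by rewrite -(ltr_int R) -(ltr_pM2r (h_gt0 n)) DE; lra.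
have m_le := mesh_width_le n.
have jE : j%:Z = j0%:Z + `|D|%N%:Z + (z - z0) * n.+1%:Z.
  by rewrite gez0_abs// /D; move: ((z - z0) * _) => t; ring.
have Dm : (`|D| < mesh_width n)%N by rewrite -ltz_nat gez0_abs.
by rewrite (ord_subr_modn _ jE)//; move: Dm m_le; clear; lia.
Unshelve. all: by end_near. Qed.

(** For large [n] distinct points of [W] occupy distinct cells, so [cells_of] is injective on
    simplices and preserves their size; closeness is [near_close_cells]. *)
Lemma near_card_close_occupied (W : set (euclid R d)) k : finite_set W ->
  W `<=` torus a -> (0 < k)%N -> \forall n \near \oo,
    #|close_occupied a W k n (mesh_width n)| =
    num_simplices (cech_complex a eps W) k.-1.
Proof.
move=> finW Wt k0; pose V := fset_set W.
have VW v : v \in V -> W v by rewrite in_fset_set// inE.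
have near_inj : \forall n \near \oo, forall v w : V, val v != val w ->
    grid_cell a n (val v) != grid_cell a n (val w).
  apply: filter_forall => v; apply: filter_forall => w.
  have [vw|vw] := eqVneq (val v) (val w); first by apply: nearW.
  have := near_grid_cell_neq (Wt _ (VW _ (valP v))) (Wt _ (VW _ (valP w))) vw.
  by apply: filterS => n + _.
have near_close : \forall n \near \oo, forall s : fpowerset V,
    cech_complex a eps W (val s) ->
    close_cells (mesh_width n) (cells_of a n (val s)).
  apply: filter_forall => s.
  have [[s0 [sW sB]]|nK] := pselect (cech_complex a eps W (val s)); last first.
    by apply: nearW.
  have := near_close_cells s0 (subset_trans sW Wt) sB.
  by apply: filterS => n + _.
near=> n.
have cell_inj : {in V &, injective (grid_cell a n)}.
  move=> v w vV wV vw; apply/eqP; apply: contra_eqT vw => vw.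
  by have /(_ n) := near near_inj; move=> /(_ _ [` vV]%fset [` wV]%fset); apply.
apply/eqP; rewrite eqn_leq card_close_occupied_le//=; last exact: mesh_width_lt.
pose S := [set s | cech_complex a eps W s /\ #|` s| = k].
have finS : finite_set S by exact: finite_simplices.
rewrite num_simplicesE// cardE.
have cells_inj : {in fset_set S &, injective (cells_of a n)}.
  move=> s t; rewrite !in_fset_set// !inE => -[[_ [sW _]] _] [[_ [tW _]] _].
  move=> /setP st; apply/fsetP => v.
  have memE (r : {fset euclid R d}) v' : [set` r] `<=` W -> v' \in V ->
      (v' \in r) = (grid_cell a n v' \in cells_of a n r).
    move=> rW v'V; rewrite inE; apply/idP/imfsetP => [v'r|[w wr vw]].
      by exists v'.
    by rewrite (cell_inj _ _ v'V _ vw)// in_fset_set// inE; exact: rW.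
  have [vV|vV] := boolP (v \in V).
    by rewrite (memE s)// (memE t)// st.
  have notV (r : {fset euclid R d}) : [set` r] `<=` W -> (v \in r) = false.
    move=> rW; apply: contraNF vV => vr.
    by rewrite in_fset_set// inE; exact: rW.
  by rewrite (notV s)// (notV t).
rewrite -(size_map (cells_of a n)); apply: uniq_leq_size => [|J].
  by rewrite map_inj_in_uniq ?fset_uniq.
move=> /mapP[s sS ->]; move: sS; rewrite in_fset_set// inE => -[sK sk].
have sV : [set` s] `<=` [set` V].
  by move=> v vs; rewrite /= in_fset_set// inE; case: sK => _ [sW _]; exact: sW.
rewrite mem_enum inE; apply/and3P; split.
- have sP : s \in fpowerset V by rewrite fpowersetE; apply/fsubsetP.
  have /(_ n) := near near_close; move=> /(_ _ [` sP]%fset); apply=> //.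
- have <- : #|` (grid_cell a n @` s)%fset| = k.
    rewrite -sk; apply/eqP/card_in_imfsetP => v w vs ws.
    by apply: cell_inj; exact: sV.
  rewrite cardE; apply/eqP/perm_size/uniq_perm; rewrite ?enum_uniq ?fset_uniq//.
  by move=> c; rewrite mem_enum inE.
- apply/fintype.subsetP => c; rewrite inE => /imfsetP[v vs ->].
  by apply/occupiedP => //; exists v => //; apply/VW/sV.
Unshelve. all: by end_near. Qed.

End near_equality.

(** * Expected number of close sets of occupied cells *)

Section grid_probability.
Context (R : realType) (d : nat) (a lambda : R).
Hypotheses (a_gt0 : 0 < a) (lambda_gt0 : 0 < lambda).
Context (disp : measure_display) (Omega : measurableType disp)
  (P : probability Omega R) (omega : Omega -> set (euclid R d)).
Hypothesis omegaP : poisson_point_process P (@torus R d a)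
  (fun A => lambda%:E * volume R d A)%E omega.
Variable n : nat.
Local Notation cell := {ffun 'I_d -> 'I_n.+1}.

Definition occupied_prob : R := 1 - expR (- (lambda * (a / n.+1%:R) ^+ d)).

Definition occupied_event (J : {set cell}) : set Omega :=
  [set w | J \subset occupied a n (omega w)].

Let points_cube_measurable (c : cell) (B : set nat) :
  measurable ((fun w => num_points (omega w) (cube a c)) @^-1` B).
Proof.
rewrite -[X in measurable X]setTI; apply: (ppp_measurable omegaP) => //.
  exact: measurable_cube.
exact: cube_torus.
Qed.

Let points_cube_neq0 (c : cell) :
  P ((fun w => num_points (omega w) (cube a c)) @^-1` [set~ 0%N]) =
  occupied_prob%:E.
Proof.
rewrite -preimage_setC probability_setC//.
have := ppp_poisson omegaP (@measurable_cube _ _ a n c)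
  (@cube_torus _ _ _ a_gt0 n c) [set 0%N].
rewrite /preimage /= => ->.
rewrite volume_cube// -EFinM/= /poisson_prob.
have r_gt0 : 0 < lambda * (a / n.+1%:R) ^+ d.
  by rewrite mulr_gt0// exprn_gt0// divr_gt0.
rewrite r_gt0 esum_set1; last by rewrite lee_fin poisson_pmf_ge0// ltW.
by rewrite /poisson_pmf r_gt0 expr0 fact0 divr1 mul1r EFinB.
Qed.

(* Independence is stated for a family indexed by 'I_p: take all the cells,
   with the sure event for those outside J. *)
Let occupied_eventE (J : {set cell}) : occupied_event J =
  \bigcap_(i : 'I_#|{: cell}|)
    ((fun w => num_points (omega w) (cube a (enum_val i))) @^-1`
      (if enum_val i \in J then [set~ 0%N] else setT)).
Proof.
apply/seteqP; split => w /=.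
  move=> /fintype.subsetP Jw i _ /=; case: ifPn => // /Jw.
  by rewrite inE => /eqP.
move=> h; apply/fintype.subsetP => c cJ; rewrite inE; apply/eqP.
by have := h (enum_rank c) I; rewrite /= enum_rankK cJ.
Qed.

Lemma occupied_event_measurable (J : {set cell}) :
  measurable (occupied_event J).
Proof.
by rewrite occupied_eventE; apply: fin_bigcap_measurable => // i _.
Qed.

Lemma probability_occupied (J : {set cell}) :
  P (occupied_event J) = (occupied_prob ^+ #|J|)%:E.
Proof.
rewrite occupied_eventE (ppp_independent omegaP); first last.
- move=> i j _ _ ij; apply: (can_inj enum_valK).
  exact: (trivIset_cube a_gt0 _ _ ij).
- by move=> i; split; [exact: measurable_cube|exact: cube_torus].
transitivity (\prod_(c : cell) (if c \in J then occupied_prob%:E else 1%E))%E.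
  rewrite (reindex (@enum_val _ {: cell})); last first.
    by exists enum_rank => x _; rewrite ?enum_valK ?enum_rankK.
  apply: eq_bigr => i _; case: ifPn => _; first exact: points_cube_neq0.
  by rewrite preimage_setT probability_setT.
by rewrite -big_mkcond/= prodEFin prodr_const.
Qed.

Variables (k m : nat).

(** Writing the count as a sum of indicators gives both its measurability and, by linearity, its
    expectation. *)
Let card_close_occupiedE w :
  (#|close_occupied a (omega w) k n m|%:R)%:E =
  (\sum_(J in [set J : {set cell} | close_cells m J & #|J| == k]%SET)
    (\1_(occupied_event J) w)%:E)%E :> \bar R.
Proof.
rewrite -sum1_card natr_sum -sumEFin big_mkcond/= [RHS]big_mkcond/=.
apply: eq_bigr => J _; rewrite !inE andbA.
case: (close_cells m J && _) => //=; case: ifPn => Jw.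
  by rewrite indicE mem_set.
by rewrite indicE memNset//; exact/negP.
Qed.

Lemma measurable_card_close_occupied :
  measurable_fun setT
    (fun w => (#|close_occupied a (omega w) k n m|%:R)%:E : \bar R).
Proof.
under eq_fun do rewrite card_close_occupiedE -big_enum/=.
apply: emeasurable_sum => J; apply/measurable_EFinP/measurable_indic.
exact: occupied_event_measurable.
Qed.

Lemma expectation_card_close_occupied :
  (\int[P]_w (#|close_occupied a (omega w) k n m|%:R)%:E =
  (#|[set J : {set cell} | close_cells m J & #|J| == k]%SET|%:R *
    occupied_prob ^+ k)%:E)%E.
Proof.
under eq_integral do rewrite card_close_occupiedE -big_enum/=.
rewrite ge0_integral_sum//; last first.
  move=> J; apply/measurable_EFinP/measurable_indic.
  exact: occupied_event_measurable.
rewrite big_enum/= mulr_natl -sumr_const -sumEFin.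
apply: eq_bigr => J; rewrite inE => /andP[_ /eqP <-].
rewrite integral_indic//; last exact: occupied_event_measurable.
by rewrite setIT; exact: probability_occupied.
Qed.

End grid_probability.

(** * Falling factorials and limits of real sequences *)

Lemma ffact_leq_expn n k : (n ^_ k <= n ^ k)%N.
Proof.
elim: k => [|k IH]; first by rewrite ffactn0 expn0.
by rewrite ffactnSr expnSr leq_mul ?leq_subr.
Qed.

Section limits.
Context (R : realType).

Lemma cvgn_eq (u : R^nat) (l l' : R) :
  l' = l -> u n @[n --> \oo] --> l' -> u n @[n --> \oo] --> l.
Proof. by move=> ->. Qed.

Lemma cvg_expn (u : R^nat) (l : R) k :
  u n @[n --> \oo] --> l -> u n ^+ k @[n --> \oo] --> l ^+ k.
Proof.
move=> ul; elim: k => [|k IH].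
  by under eq_fun do rewrite expr0; rewrite expr0; exact: cvg_cst.
by under eq_fun do rewrite exprS; rewrite exprS; exact: cvgM.
Qed.

Lemma cvg_sumn (I : Type) (r : seq I) (u : I -> R^nat) (l : I -> R) :
  (forall i, u i n @[n --> \oo] --> l i) ->
  \sum_(i <- r) u i n @[n --> \oo] --> \sum_(i <- r) l i.
Proof.
move=> ul; elim: r => [|i r IH].
  by under eq_fun do rewrite big_nil; rewrite big_nil; exact: cvg_cst.
by under eq_fun do rewrite big_cons; rewrite big_cons; exact: cvgD.
Qed.

(** The proportion of injective [k]-tuples among all [k]-tuples tends to 1; each further entry
    contributes a factor [(N - k) / N]. *)
Lemma cvg_ffact_ratio (N : nat^nat) k : (N n)%:R^-1 @[n --> \oo] --> (0 : R) ->
  (forall n, 0 < N n)%N ->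
  (N n ^_ k)%:R / (N n)%:R ^+ k @[n --> \oo] --> (1 : R).
Proof.
move=> Noo N0; elim: k => [|k IH].
  by under eq_fun do rewrite expr0 ffactn0 divr1; exact: cvg_cst.
have step n : (N n ^_ k.+1)%:R / (N n)%:R ^+ k.+1 =
    ((N n ^_ k)%:R / (N n)%:R ^+ k) * ((N n - k)%:R / (N n)%:R) :> R.
  by rewrite ffactnSr exprSr natrM invfM; ring.
under eq_fun do rewrite step.
apply: (cvgn_eq (mulr1 _)); apply: cvgM => //.
(* The subtraction [N n - k] is truncated, but the lower bound [1 - k / N] holds also when
   [N n < k]. *)
apply: (@squeeze_cvgr _ _ _ _ (fun n => 1 - k%:R * (N n)%:R^-1) (fun=> 1)).
- near=> n; have N0R : 0 < (N n)%:R :> R by rewrite ltr0n.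
  rewrite ler_pdivlMr// ler_pdivrMr// mul1r ler_nat leq_subr andbT.
  rewrite mulrBl mul1r mulfVK ?gt_eqF//.
  by rewrite lerBlDr -natrD ler_nat; lia.
- apply: (cvgn_eq (subr0 _)); apply: cvgB; first exact: cvg_cst.
  by apply: (cvgn_eq (mulr0 k%:R)); apply: cvgM => //; exact: cvg_cst.
- exact: cvg_cst.
Unshelve. all: by end_near. Qed.

End limits.

(** * Asymptotics of the expected count *)

Section expected_limit.
Context (R : realType) (d : nat) (a lambda eps : R).
Hypotheses (d_gt0 : (0 < d)%N) (a_gt0 : 0 < a) (lambda_gt0 : 0 < lambda)
  (eps_gt0 : 0 < eps) (eps_lt : eps < a / 4).

Let h n := a / n.+1%:R.
Let h_gt0 n : 0 < h n := mesh_gt0 a_gt0 n.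
Let m n := mesh_width a eps n.

Let cvg_h : h n @[n --> \oo] --> 0.
Proof.
apply: (cvgn_eq (mulr0 a)); apply: cvgM; first exact: cvg_cst.
exact: cvg_harmonic.
Qed.

Let cvg_mh : (m n)%:R * h n @[n --> \oo] --> 2 * eps.
Proof.
apply: (@squeeze_cvgr _ _ _ _ (fun n => 2 * eps - 2 * h n) (fun=> 2 * eps)).
- near=> n; apply/andP; split; apply/ltW.
    exact: mesh_width_gt.
  exact: mesh_width_lt.
- apply: (cvgn_eq (subr0 _)); apply: cvgB; first exact: cvg_cst.
  by apply: (cvgn_eq (mulr0 2)); apply: cvgM => //; exact: cvg_cst.
- exact: cvg_cst.
Unshelve. all: by end_near. Qed.

Let cvg_ratio : (m n)%:R / n.+1%:R @[n --> \oo] --> 2 * eps / a.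
Proof.
under eq_fun => n.
  rewrite (_ : _ / _ = (m n)%:R * h n / a); last first.
    by rewrite /h mulrA mulrAC mulfK ?gt_eqF//.
  over.
by apply: cvgM => //; exact: cvg_cst.
Qed.

Let cvg_ratio_pred : (m n).-1%:R / n.+1%:R @[n --> \oo] --> 2 * eps / a.
Proof.
apply: (@squeeze_cvgr _ _ _ _ (fun n => (m n)%:R / n.+1%:R - n.+1%:R^-1)
  (fun n => (m n)%:R / n.+1%:R)) => //.
- near=> n; rewrite -[X in _ - X]mul1r -mulrBl !ler_pM2r ?invr_gt0//.
  by rewrite ler_nat leq_pred andbT lerBlDr natr1 ler_nat; lia.
- apply: (cvgn_eq (subr0 _)); apply: cvgB => //.
  exact: cvg_harmonic.
Unshelve. all: by end_near. Qed.

Let near_m_gt0 : \forall n \near \oo, (0 < m n)%N.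
Proof.
near=> n; rewrite lt0n; apply/negP => /eqP m0.
have := mesh_width_gt a_gt0 eps_gt0 n; rewrite -/(m n) -/(h n) m0 mul0r.
have : h n < eps by near: n; exact: near_mesh_lt.
by lra.
Unshelve. all: by end_near. Qed.

Let arcs k n := (n.+1 * (m n ^ k - (m n).-1 ^ k))%N.

(** The difference of [k]-th powers factors as [m - m.-1 = 1] times a sum of [k] products, each of
    which tends to the same power of [2 * eps / a] after scaling. *)
Let cvg_arcs k : (0 < k)%N ->
  (arcs k n)%:R / n.+1%:R ^+ k @[n --> \oo] --> k%:R * (2 * eps / a) ^+ k.-1.
Proof.
case: k => // k _.
have cvg_sum : \sum_(i < k.+1) ((m n)%:R / n.+1%:R) ^+ (k.+1.-1 - i) *
      ((m n).-1%:R / n.+1%:R) ^+ i @[n --> \oo] -->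
    \sum_(i < k.+1) (2 * eps / a) ^+ (k.+1.-1 - i) * (2 * eps / a) ^+ i.
  by apply: cvg_sumn => i; apply: cvgM; exact: cvg_expn.
have sumE :
    \sum_(i < k.+1) (2 * eps / a) ^+ (k.+1.-1 - i) * (2 * eps / a) ^+ i =
    k.+1%:R * (2 * eps / a) ^+ k.
  transitivity (\sum_(i < k.+1) (2 * eps / a) ^+ k).
    by apply: eq_bigr => i _; rewrite -exprD subnK// -ltnS ltn_ord.
  by rewrite sumr_const card_ord -[LHS]mulr_natl.
rewrite sumE in cvg_sum; apply: cvg_trans cvg_sum.
apply: near_eq_cvg; near=> n.
have m0 : (0 < m n)%N by near: n.
rewrite /arcs natrM natrB; last by rewrite leq_exp2r// leq_pred.
rewrite !natrX [n.+1%:R ^+ _]exprS invfM mulrACA mulfV ?pnatr_eq0// mul1r.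
rewrite subrXX.
have -> : (m n)%:R - (m n).-1%:R = 1 :> R.
  by rewrite -natrB ?leq_pred// -[in X in (X - _)%N](prednK m0) subSnn.
rewrite mul1r mulr_suml; apply: eq_bigr => i _.
rewrite !exprMn !exprVn mulrACA -invfM -exprD subnK//.
by rewrite -ltnS ltn_ord.
Unshelve. all: by end_near. Qed.

Let p n := occupied_prob d a lambda n.
Let N n := (n.+1 ^ d)%N.

(** With [x] the mean number of points in a cube, [x * N] is constant and
    [x / (1 + x) <= 1 - exp (- x) <= x]. *)
Let cvg_pN : p n * (N n)%:R @[n --> \oo] --> lambda * a ^+ d.
Proof.
pose x n := lambda * h n ^+ d.
have x_gt0 n : 0 < x n by rewrite mulr_gt0// exprn_gt0.
have xN n : x n * (N n)%:R = lambda * a ^+ d.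
  by rewrite /x natrX -mulrA -exprMn mulrC /h mulfVK ?pnatr_eq0// mulrC.
have N_gt0 n : 0 < (N n)%:R :> R by rewrite ltr0n expn_gt0.
apply: (@squeeze_cvgr _ _ _ _ (fun n => lambda * a ^+ d / (1 + x n))
  (fun=> lambda * a ^+ d)).
- near=> n; have x1_gt0 : 0 < 1 + x n by rewrite addr_gt0.
  rewrite -(xN n) mulrAC !ler_pM2r//; apply/andP; split.
    rewrite /p /occupied_prob -/(h n) -/(x n) lerBrDr -lerBrDl expRN.
    rewrite (_ : 1 - _ = (1 + x n)^-1).
      by rewrite lef_pV2 ?posrE ?expR_gt0// expR_ge1Dx.
    by field; rewrite gt_eqF.
  rewrite /p /occupied_prob -/(h n) -/(x n).
  by have := expR_ge1Dx (- x n); lra.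
- apply: (cvgn_eq (divr1 _)); apply: cvgM; first exact: cvg_cst.
  apply: cvgV; first exact: oner_neq0.
  apply: (cvgn_eq (addr0 _)); apply: cvgD; first exact: cvg_cst.
  apply: (cvgn_eq (mulr0 lambda)); apply: cvgM; first exact: cvg_cst.
  by have := cvg_expn (k := d) cvg_h; rewrite expr0n gtn_eqF.
- exact: cvg_cst.
Unshelve. all: by end_near. Qed.

Lemma cvg_expected_close_cells k : (0 < k)%N ->
  #|[set J : {set {ffun 'I_d -> 'I_n.+1}} |
      close_cells (mesh_width a eps n) J & #|J| == k]%SET|%:R *
    occupied_prob d a lambda n ^+ k @[n --> \oo] -->
  lambda * a ^+ d * (lambda * (2 * eps) ^+ d) ^+ k.-1 * k%:R ^+ d / k`!%:R.
Proof.
move=> k_gt0.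
have N_gt0 n : (0 < N n)%N by rewrite expn_gt0.
have cvg_invN : (N n)%:R^-1 @[n --> \oo] --> (0 : R).
  under eq_fun do rewrite natrX -exprVn.
  by have := cvg_expn (k := d) (@cvg_harmonic R); rewrite expr0n gtn_eqF.
have cvgT : (arcs k n ^ d)%:R * p n ^+ k @[n --> \oo] -->
    (k%:R * (2 * eps / a) ^+ k.-1) ^+ d * (lambda * a ^+ d) ^+ k.
  under eq_fun => n.
    rewrite (_ : _ * _ =
      ((arcs k n)%:R / n.+1%:R ^+ k) ^+ d * (p n * (N n)%:R) ^+ k); last first.
      rewrite natrX !exprMn exprVn /N natrX -!exprM (mulnC d).
      by rewrite mulrACA mulVf ?mulr1 ?expf_neq0 ?pnatr_eq0.
    over.
  by apply: cvgM; apply: cvg_expn => //; exact: cvg_arcs.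
(* The error from non-injective tuples: their proportion tends to 0 while [(p * N) ^ k] stays
   bounded. *)
have cvgE : (N n ^ k - N n ^_ k)%:R * p n ^+ k @[n --> \oo] --> (0 : R).
  under eq_fun => n.
    rewrite (_ : _ * _ = (1 - (N n ^_ k)%:R / (N n)%:R ^+ k) *
        (p n * (N n)%:R) ^+ k); last first.
      have : (N n)%:R ^+ k != 0 :> R by rewrite expf_neq0// pnatr_eq0 -lt0n.
      rewrite natrB ?ffact_leq_expn// natrX exprMn.
      by move: (_ ^+ k) => X X0; field.
    over.
  apply: (cvgn_eq (mul0r ((lambda * a ^+ d) ^+ k))); apply: cvgM.
    apply: (cvgn_eq (subrr 1)); apply: cvgB; first exact: cvg_cst.
    exact: cvg_ffact_ratio.
  exact: cvg_expn.
have p_ge0 n : 0 <= p n.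
  rewrite /p /occupied_prob subr_ge0 -[leRHS]expR0 ler_expR oppr_le0.
  by apply: mulr_ge0; [exact: ltW|exact/exprn_ge0/ltW/mesh_gt0].
have -> : lambda * a ^+ d * (lambda * (2 * eps) ^+ d) ^+ k.-1 * k%:R ^+ d /
    k`!%:R = ((k%:R * (2 * eps / a) ^+ k.-1) ^+ d * (lambda * a ^+ d) ^+ k) /
    k`!%:R.
  case: k k_gt0 {cvgT cvgE} => // k _; congr (_ / _); rewrite /=.
  rewrite (_ : lambda * (2 * eps) ^+ d =
      (2 * eps / a) ^+ d * (lambda * a ^+ d)).
    move: (2 * eps / a) (lambda * a ^+ d) => r t.
    by rewrite exprS !exprMn (exprAC _ k d); ring.
  by rewrite expr_div_n mulrCA divfK// expf_neq0// gt_eqF.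
have fact_gt0 : 0 < k`!%:R :> R by rewrite ltr0n fact_gt0.
(* The two bounds of [card_close_cells], multiplied by [p ^ k / k!]. *)
apply: (@squeeze_cvgr _ _ _ _
  (fun n => ((arcs k n ^ d)%:R * p n ^+ k -
             (N n ^ k - N n ^_ k)%:R * p n ^+ k) / k`!%:R)
  (fun n => (arcs k n ^ d)%:R * p n ^+ k / k`!%:R)).
- near=> n; rewrite -/(p n).
  have [] := card_close_cells d k_gt0 (mesh_width_le a_gt0 eps_gt0 eps_lt n).
  rewrite -/(N n) -/(m n) -/(arcs k n); move: #|_| => J.
  rewrite -!(ler_nat R) natrD natrM => lo hi.
  have pk_ge0 := exprn_ge0 k (p_ge0 n).
  rewrite -mulrBl ler_pdivrMr// ler_pdivlMr// [J%:R * _ * _]mulrAC.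
  by rewrite !ler_wpM2r//; lra.
- apply: cvgM; last exact: cvg_cst.
  by apply: (cvgn_eq (subr0 _)); apply: cvgB.
- by apply: cvgM => //; exact: cvg_cst.
Unshelve. all: by end_near. Qed.

End expected_limit.

(** * Passage to the limit under the expectation *)

Unset Implicit Arguments.

Theorem theorem9 (R : realType) (d : nat) (a lambda eps : R)
  (hd : (1 <= d)%N) (ha : 0 < a) (hlambda : 0 < lambda)
  (heps0 : 0 < eps) (heps : eps < a / 4)
  (disp : measure_display) (Omega : measurableType disp)
  (P : probability Omega R) (omega : Omega -> set (euclid R d))
  (homega : poisson_point_process P (@torus R d a)
              (fun A => lambda%:E * volume R d A)%E omega)
  (k : nat) (hk : (1 <= k)%N) :
  'E_P[fun w => (num_simplices (cech_complex a eps (omega w)) k.-1)%:R]%E =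
    (lambda * a ^+ d * (lambda * (2 * eps) ^+ d) ^+ k.-1 * k%:R ^+ d
      / k`!%:R)%:E.
Proof.
pose L n w : \bar R :=
  (#|close_occupied a (omega w) k n (mesh_width a eps n)|%:R)%:E.
pose N w : \bar R :=
  ((num_simplices (cech_complex a eps (omega w)) k.-1)%:R)%:E.
have sub := ppp_sub homega; have fin := ppp_finite homega.
have mL n : measurable_fun setT (L n).
  exact: (measurable_card_close_occupied ha homega).
have L_ge0 n w : (0 <= L n w)%E by rewrite lee_fin.
have LN n w : (L n w <= N w)%E.
  rewrite lee_fin ler_nat; apply: card_close_occupied_le => //.
  exact: mesh_width_lt.
have cvgL w : L n w @[n --> \oo] --> N w.
  apply: cvg_near_cst.
  have := near_card_close_occupied ha heps0 heps (fin w) (sub w) hk.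
  by apply: filterS => n; rewrite /L /N => ->.
(* The point process axioms give measurability of cell counts only; that of [N] comes from the
   pointwise limit. *)
have mN : measurable_fun setT N.
  by apply: (emeasurable_fun_cvg L) => // w _; exact: cvgL.
rewrite unlock -/(N _).
set l := (X in X%:E).
have cvgIL : (\int[P]_w L n w)%E @[n --> \oo] --> l%:E.
  under eq_fun => n.
    rewrite (expectation_card_close_occupied ha hlambda homega); over.
  apply/fine_cvgP; split; first exact: nearW.
  exact: cvg_expected_close_cells.
apply/eqP; rewrite eq_le; apply/andP; split.
  (* Upper bound by Fatou's lemma, since [N] is the pointwise lower limit of the [L n]. *)
  rewrite -(cvg_limn_einf_sup cvgIL).1.
  rewrite (eq_integral (fun w => limn_einf (L^~ w))); last first.
    by move=> w _; rewrite (cvg_limn_einf_sup (cvgL w)).1.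
  by apply: fatou.
(* Lower bound by monotonicity of the integral, from [L n <= N]. *)
rewrite -(cvg_lim _ cvgIL)//; apply: lime_le; first by apply: cvgP cvgIL.
by apply: nearW => n; apply: ge0_le_integral.
Qed.
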